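(* Let $1\le k\le\lfloor n/2\rfloor$ and let $G_{k\times n}=[\mathbb{1}_k\,|\,A]$, with $A=(a_{i,j})\in GF(q)^{k\times(n-k)}$, be a generator matrix in standard form of an MDS code $[n,k,n-k+1]_q$. Let $G_{\widehat{k}}=[\mathbb{1}_{k-1}\,|\,A_{(k-1)\times(n-k)}]$ be the $(k-1)\times(n-1)$ matrix obtained from $G_{k\times n}$ by deleting its $k$-th row and $k$-th column, and let $$|\psi_0\rangle=\sum_{\vec v\in GF(q)^{k-1}}|\vec v\,G_{\widehat{k}}\rangle\in(\mathbb{C}^q)^{\otimes(n-1)},$$ which is a $(k-1)$-uniform state. Define the Pauli string, built from the elements of the last row of $G_{k\times n}$, $$M=\underbrace{\mathbb{1}\otimes\cdots\otimes\mathbb{1}}_{k-1}\otimes\underbrace{X^{a_{k,1}}\otimes X^{a_{k,2}}\otimes\cdots\otimes X^{a_{k,n-k}}}_{n-k}.$$ Put $$|\psi_m\rangle=M^m|\psi_0\rangle,\qquad 0\le m\le q-1 .$$ Then the subspace $\mathcal{C}=\operatorname{span}\{|\psi_m\rangle : 0\le m\le q-1\}\subset(\mathbb{C}^q)^{\otimes(n-1)}$ is a quantum error correcting code with parameters $[\![n-1,1,k]\!]_q$.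
   Context: **Classical codes.** A linear code $[n,k,d_H]_q$ is a $k$-dimensional subspace of $GF(q)^n$ with minimum Hamming distance $d_H$; it is MDS if $d_H=n-k+1$. **Pauli operators.** $X|j\rangle=|j+1 \bmod q\rangle$ and $Z|j\rangle=\omega^j|j\rangle$ with $\omega=e^{2\pi i/q}$, where $|j\rangle$ are the computational basis states of $\mathbb{C}^q$. A Pauli string is a tensor product of powers of these operators; the exponents above are elements of $GF(q)$ (for $q$ prime, integers mod $q$), and $M^m$ is the $m$-th power of $M$. For a vector $w$ over $GF(q)$, $|w\rangle=|w_1\rangle\otimes|w_2\rangle\otimes\cdots$. States are understood up to normalization. **Uniform states.** A pure state of several qudits of dimension $q$ is $r$-uniform if its reduced density matrix on every set of at most $r$ parties is proportional to the identity. **Quantum codes.** The weight $\operatorname{wt}(W)$ of an operator $W$ is the number of tensor factors on which it acts non-trivially. A subspace $\mathcal{C}\subset(\mathbb{C}^q)^{\otimes N}$ of dimension $q^{\tilde k}$ with orthonormal basis $\{|\psi_m\rangle\}$ is a quantum error correcting code with parameters $[\![N,\tilde k,d]\!]_q$ if $\langle\psi_m|E^\dagger F|\psi_{m'}\rangle=f(E^\dagger F)\,\delta_{m,m'}$ for all $m,m'$ and all errors $E,F$ with $\operatorname{wt}(E^\dagger F)<d$ (where $f$ does not depend on $m$), $d$ being the distance of the code: the minimal weight of an operator $W$ for which $\langle\psi|W|\psi'\rangle\neq0$ for some $\psi,\psi'\in\mathcal{C}$ with $\langle\psi|\psi'\rangle=0$.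
   Formalization: For q not prime, X^a is read as |j⟩→|j+a⟩ with addition in GF(q), and m ranges over GF(q) with M^m = 1⊗…⊗X^{m a_{k,1}}⊗…⊗X^{m a_{k,n-k}}; with integer powers the span can have dimension below q. For q prime this is the statement as written. *)

(* Defs.v *)
From HB Require Import structures.
From mathcomp Require Import all_boot all_order all_algebra all_field.
From mathcomp Require Import boolp reals complex.

Set Implicit Arguments.
Unset Strict Implicit.
Unset Printing Implicit Defensive.

Import Order.TTheory GRing.Theory Num.Theory.
Local Open Scope ring_scope.

(* Throughout, F is the field GF(q) with q = #|F|, and C is
   the field of amplitudes, with conjugation z^*; it is instantiated by R[i]
   for a realType R. *)

Section ClassicalCodes.
Variable F : finFieldType.

Definition hamming_dist l (x y : 'rV[F]_l) : nat :=
  #|[set i | x 0 i != y 0 i]|.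

Definition is_min_dist l (D : {vspace 'rV[F]_l}) (d : nat) : Prop :=
  (exists x y, [/\ x \in D, y \in D, x != y & hamming_dist x y = d]) /\
  (forall x y, x \in D -> y \in D -> x != y -> (d <= hamming_dist x y)%N).

(* The length n is separate from the dimension l in the type of D because the
   two are often equal only propositionally, e.g. l = k + (n - k). *)
Definition is_linear_code l (D : {vspace 'rV[F]_l}) (n k d : nat) : Prop :=
  [/\ l = n, \dim D = k & is_min_dist D d].

Definition is_MDS l (D : {vspace 'rV[F]_l}) (n k : nat) : Prop :=
  is_linear_code D n k (n - k + 1).

Definition is_generator_matrix k l (G : 'M[F]_(k, l))
    (D : {vspace 'rV[F]_l}) : Prop :=
  basis_of D [seq row i G | i : 'I_k].

End ClassicalCodes.

(* The Hilbert space with orthonormal basis (ket t), t : T. *)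
Notation hilbert C T := {ffun T -> C^o}.
Notation qudit C F := (hilbert C F).
(* (C^q)^{(x) N}, with |w> = |w_1> (x) ... (x) |w_N> for w : 'rV[F]_N. *)
Notation state C F N := (hilbert C 'rV[F]_N).

Section HilbertSpace.
Variables (C : numClosedFieldType) (T : finType).

Definition ket (t : T) : hilbert C T := [ffun s => (s == t)%:R].

Definition braket (phi psi : hilbert C T) : C :=
  \sum_t (phi t : C)^* * psi t.

(* <s| W |t> *)
Definition mel (s : T) (W : 'End(hilbert C T)) (t : T) : C :=
  braket (ket s) (W (ket t)).

Definition op_of_mel (w : T -> T -> C) : 'End(hilbert C T) :=
  linfun (fun psi : hilbert C T =>
            [ffun s => \sum_t w s t * psi t] : hilbert C T).

Definition adjoint (W : 'End(hilbert C T)) : 'End(hilbert C T) :=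
  op_of_mel (fun s t => (mel t W s)^*).

Fact op_of_mel_linear (w : T -> T -> C) :
  linear (fun psi : hilbert C T =>
            [ffun s => \sum_t w s t * psi t] : hilbert C T).
Proof.
move=> a u v; apply/ffunP=> s; rewrite !ffunE scaler_sumr -big_split /=.
by apply: eq_bigr => t _; rewrite !ffunE /GRing.scale /= mulrDr mulrCA.
Qed.

Lemma op_of_melE w (psi : hilbert C T) s :
  op_of_mel w psi s = \sum_t w s t * psi t.
Proof.
pose L := GRing.isLinear.Build _ _ _ _ _ (op_of_mel_linear w).
pose f : {linear hilbert C T -> hilbert C T} := HB.pack
  (fun psi : hilbert C T => [ffun s => \sum_t w s t * psi t] : hilbert C T) L.
by rewrite /op_of_mel (lfunE f) /= ffunE.
Qed.

Lemma braket_ket s (psi : hilbert C T) : braket (ket s) psi = psi s.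
Proof.
rewrite /braket (bigD1 s) //= ffunE eqxx rmorph1 mul1r big1 ?addr0 // => u.
by rewrite ffunE => /negbTE->; rewrite rmorph0 mul0r.
Qed.

Lemma mel_op_of_mel w s t : mel s (op_of_mel w) t = w s t.
Proof.
rewrite /mel braket_ket op_of_melE (bigD1 t) //= ffunE eqxx mulr1.
by rewrite big1 ?addr0 // => u; rewrite ffunE => /negbTE->; rewrite mulr0.
Qed.

Lemma ket_sum (psi : hilbert C T) : psi = \sum_t (psi t : C) *: ket t.
Proof.
apply/ffunP=> s; rewrite sum_ffunE (bigD1 s) //= !ffunE eqxx.
rewrite [_ *: _]mulr1 big1 ?addr0 // => u; rewrite !ffunE eq_sym => /negbTE->.
by rewrite scaler0.
Qed.

Lemma mel_apply (W : 'End(hilbert C T)) psi s :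
  W psi s = \sum_t mel s W t * psi t.
Proof.
rewrite {1}(ket_sum psi) linear_sum sum_ffunE; apply: eq_bigr => t _.
by rewrite linearZ ffunE /mel braket_ket /GRing.scale /= mulrC.
Qed.

Lemma adjointE (W : 'End(hilbert C T)) phi psi :
  braket phi (W psi) = braket (adjoint W phi) psi.
Proof.
rewrite /braket; under [RHS]eq_bigr => t _.
  rewrite op_of_melE rmorph_sum /= mulr_suml; over.
rewrite exchange_big /=; apply: eq_bigr => s _.
rewrite mel_apply mulr_sumr; apply: eq_bigr => t _.
by rewrite rmorphM /= conjCK mulrCA mulrA.
Qed.

End HilbertSpace.

Arguments ket {C T}.

Section Qudits.
Variables (C : numClosedFieldType) (F : finFieldType).

Definition tensor_op N (P : 'I_N -> 'End(qudit C F)) : 'End(state C F N) :=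
  op_of_mel (fun x y : 'rV[F]_N => \prod_i mel (x 0 i) (P i) (y 0 i)).

(* X |j> = |j + 1>; and X^a |j> = |j + a> for an exponent a in F.  The lemmas
   below show that for a = m%:R (every a if q is prime) this is the
   m-th power of X. *)
Definition pauli_X : 'End(qudit C F) :=
  op_of_mel (fun s t => (s == t + 1)%:R).

Definition pauli_Xpow (a : F) : 'End(qudit C F) :=
  op_of_mel (fun s t => (s == t + a)%:R).

(* X^{e_1} (x) ... (x) X^{e_N} *)
Definition X_string N (e : 'rV[F]_N) : 'End(state C F N) :=
  tensor_op (fun i => pauli_Xpow (e 0 i)).

(* M^m for M = X_string e and an exponent m in F. *)
Definition X_string_pow N (e : 'rV[F]_N) (m : F) : 'End(state C F N) :=
  X_string (m *: e).

Lemma pauli_Xpow_ket a j : pauli_Xpow a (ket j) = ket (j + a).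
Proof.
by apply/ffunP=> s; rewrite -braket_ket -/(mel _ _ _) mel_op_of_mel ffunE.
Qed.

Lemma X_string_ket N (e w : 'rV[F]_N) : X_string e (ket w) = ket (w + e).
Proof.
apply/ffunP=> x; rewrite -braket_ket -/(mel _ _ _) mel_op_of_mel ffunE.
under eq_bigr do rewrite mel_op_of_mel.
have [->|nex] := eqVneq x (w + e).
  by rewrite big1 // => i _; rewrite mxE eqxx.
have [i nei] : exists i, x 0 i != (w + e) 0 i.
  apply/existsP; apply: contraR nex; rewrite negb_exists => /forallP eqx.
  by apply/eqP/rowP => i; apply/eqP; have := eqx i; rewrite negbK.
by rewrite (bigD1 i) //=; rewrite mxE in nei; rewrite (negbTE nei) mul0r.
Qed.

Lemma iter_op_ket (T : finType) (W : 'End(hilbert C T)) (V : 'End(hilbert C T))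
    m (g : T -> T) :
  (forall t, W (ket t) = ket (g t)) ->
  (forall t, V (ket t) = ket (iter m g t)) ->
  forall psi, V psi = iter m W psi.
Proof.
move=> Wg Vg psi; rewrite (ket_sum psi) linear_sum /=.
have -> : iter m W (\sum_t (psi t : C) *: ket t)
          = \sum_t (psi t : C) *: iter m W (ket t).
  elim: m {Vg} => //= m ->; rewrite linear_sum /=.
  by apply: eq_bigr => t _; rewrite linearZ.
apply: eq_bigr => t _; rewrite linearZ /= Vg; congr (_ *: _).
by elim: m {Vg} => //= m <-; rewrite Wg.
Qed.

Lemma pauli_Xpow1 : pauli_Xpow 1 = pauli_X. Proof. by []. Qed.

Lemma pauli_Xpow_nat m psi : pauli_Xpow m%:R psi = iter m pauli_X psi.
Proof.
apply: (iter_op_ket (g := fun t => t + 1)) => t.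
  by rewrite -pauli_Xpow1 pauli_Xpow_ket.
rewrite pauli_Xpow_ket; congr ket.
by elim: m => [|m IHm] /=; rewrite ?addr0 // -IHm -natr1 addrA.
Qed.

Lemma X_string_pow_nat N (e : 'rV[F]_N) m psi :
  X_string_pow e m%:R psi = iter m (X_string e) psi.
Proof.
apply: (iter_op_ket (g := fun t => t + e)) => t; rewrite X_string_ket //.
congr ket; elim: m => [|m IHm] /=; first by rewrite scale0r addr0.
by rewrite -IHm -[m.+1%:R]natr1 scalerDl scale1r addrA.
Qed.

(* rho_S = Tr_{~: S} |psi><psi|, as its matrix elements <x| rho_S |x'>; the
   words of the subsystem S are obtained from the full ones by restriction. *)
Definition restr N (S : {set 'I_N}) (w : 'rV[F]_N) : 'rV[F]_#|S| :=
  colsub (fun j : 'I_#|S| => enum_val j) w.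

Definition reduced_density N (psi : state C F N) (S : {set 'I_N})
    (x x' : 'rV[F]_#|S|) : C :=
  \sum_(w | restr S w == x)
    \sum_(w' | (restr S w' == x') && (restr (~: S) w == restr (~: S) w'))
      (psi w : C) * (psi w' : C)^*.

Arguments reduced_density {N} psi S x x'.

Definition is_uniform N (r : nat) (psi : state C F N) : Prop :=
  psi != 0 /\
  forall S : {set 'I_N}, (#|S| <= r)%N ->
    exists c : C, forall x x',
      reduced_density psi S x x' = c * (x == x')%:R.

(* W = 1_i (x) W' with W' acting on the other N - 1 factors. *)
Definition acts_trivially N (W : 'End(state C F N)) (i : 'I_N) : Prop :=
  exists W' : 'End(state C F N.-1), forall x y : 'rV[F]_N,
    mel x W y = (x 0 i == y 0 i)%:R * mel (col' i x) W' (col' i y).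

Definition weight N (W : 'End(state C F N)) : nat :=
  #|[set i : 'I_N | `[< ~ acts_trivially W i >]]|.

(* The matrix elements vanish off the diagonal, and on it do not depend on
   the basis state. *)
Definition knill_laflamme N K (psi : 'I_K -> state C F N) (d : nat) : Prop :=
  exists f : 'End(state C F N) -> C,
    forall (m m' : 'I_K) (E1 E2 : 'End(state C F N)),
      let W := (adjoint E1 \o E2)%VF in
      (weight W < d)%N -> braket (psi m) (W (psi m')) = f W * (m == m')%:R.

Definition confuses N (Q : {vspace state C F N}) (W : 'End(state C F N)) :
    Prop :=
  exists phi psi, [/\ phi \in Q, psi \in Q, braket phi psi = 0
                    & braket phi (W psi) != 0].

Definition is_distance N (Q : {vspace state C F N}) (d : nat) : Prop :=
  (exists2 W, confuses Q W & weight W = d) /\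
  (forall W, confuses Q W -> (d <= weight W)%N).

(* Q is an [[n, kt, d]]_q code; as for classical codes, n is separate from the
   dimension N in the type of Q. *)
Definition is_QECC N (Q : {vspace state C F N}) (n kt d : nat) : Prop :=
  [/\ N = n,
      \dim Q = (#|F| ^ kt)%N,
      exists psi : 'I_(#|F| ^ kt) -> state C F N,
        [/\ basis_of Q (codom psi),
            forall m m', braket (psi m) (psi m') = (m == m')%:R
          & knill_laflamme psi d]
    & is_distance Q d].

(* sum_v |v G>, unnormalized *)
Definition code_state k N (G : 'M[F]_(k, N)) : state C F N :=
  \sum_(v : 'rV[F]_k) ket (v *m G).

End Qudits.

Definition last_ord k (hk : (0 < k)%N) : 'I_k :=
  Ordinal (etrans (ltn_predL k) hk).

(* Main.v *)
(* Deleting the k-th coordinate of the MDS code D leaves the words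
   w(u, m) = u Ghat + m e, so psi_m is the sum of the kets |w(u, m)> over u.
   The distance of D makes any k - 1 positions determine u when m is known, and
   any k positions determine u and m.  As 2k <= n, two words that agree outside
   a set S of at most k - 1 positions are therefore equal, which kills the
   off-diagonal terms of a reduced density matrix on S and of an operator
   supported on S; the diagonal terms are constant because the words u Ghat take
   every value on S.  Conversely, the projector onto the vanishing of k chosen
   coordinates fixes |0> and annihilates the other words, so it confuses
   psi_0 + psi_1 with psi_0 - psi_1. *)

Require Import Defs.
From mathcomp Require Import all_boot all_order all_algebra all_field.
From mathcomp Require Import boolp reals complex.
From mathcomp Require Import zify.

Set Implicit Arguments.
Unset Strict Implicit.
Unset Printing Implicit Defensive.

Import Order.TTheory GRing.Theory Num.Theory.
Local Open Scope ring_scope.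

Lemma exists_superset_card (T : finType) (S : {set T}) r :
  (#|S| <= r <= #|T|)%N -> exists2 S' : {set T}, S \subset S' & #|S'| = r.
Proof.
case/andP=> /subnKC <-; elim: (r - #|S|)%N => [|d IHd] ledT.
  by exists S; rewrite ?addn0.
have [|S' sSS' cardS'] := IHd; first by rewrite (leq_trans _ ledT) ?leq_add2l.
have : (0 < #|~: S'|)%N by rewrite cardsCs setCK cardS' subn_gt0 -addnS.
case/card_gt0P => i; rewrite inE => Si.
exists (i |: S'); first by rewrite (subset_trans sSS') ?subsetUr.
by rewrite cardsU1 Si cardS' addnS.
Qed.

(** * Sesquilinear expansions and orthonormal families *)

Section HilbertSpace.
Variables (C : numClosedFieldType) (T : finType).
Implicit Types (phi psi : hilbert C T) (W : 'End(hilbert C T)).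

(** The operator in the middle lets one expansion serve matrix elements and, with [W] the identity,
    plain inner products; hence the later insertions of [\1%VF]. *)
Lemma braket_sum (I J : finType) (a : I -> C) (b : J -> C)
    (f : I -> hilbert C T) (g : J -> hilbert C T) W :
  braket (\sum_i a i *: f i) (W (\sum_j b j *: g j))
  = \sum_i \sum_j (a i)^* * b j * braket (f i) (W (g j)).
Proof.
have -> : W (\sum_j b j *: g j) = \sum_j b j *: W (g j).
  by rewrite linear_sum; apply: eq_bigr => j _; rewrite linearZ.
rewrite /braket.
under [RHS]eq_bigr do under eq_bigr do rewrite mulr_sumr.
under [RHS]eq_bigr do rewrite exchange_big.
rewrite exchange_big; apply: eq_bigr => t _ /=.
rewrite !sum_ffunE rmorph_sum mulr_suml; apply: eq_bigr => i _.
rewrite mulr_sumr; apply: eq_bigr => j _.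
by rewrite !ffunE /GRing.scale /= rmorphM /= mulrACA.
Qed.

Lemma braketZ a b phi psi W :
  braket (a *: phi) (W (b *: psi)) = a^* * b * braket phi (W psi).
Proof.
have := braket_sum (fun _ : unit => a) (fun _ : unit => b) (fun=> phi)
  (fun=> psi) W.
by rewrite !(big_pred1 tt) // => -[].
Qed.

Lemma mem_span_codom (I : finType) (f : I -> hilbert C T) phi :
  phi \in <<codom f>>%VS -> exists a : I -> C, phi = \sum_i a i *: f i.
Proof.
move=> /(coord_span (X := codom_tuple f)) ->.
exists (fun i => coord (codom_tuple f) (enum_rank i) phi).
rewrite (reindex _ (onW_bij _ (enum_rank_bij I))) /=.
by apply: eq_bigr => i _; rewrite nth_codom enum_rankK.
Qed.

(** Pairing a vanishing combination with one vector of the family isolates its coefficient. *)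
Lemma orthonormal_free (I : finType) (f : I -> hilbert C T) :
  (forall i j, braket (f i) (f j) = (i == j)%:R) -> free (codom f).
Proof.
move=> orth; apply/(freeP (X := codom_tuple f)) => a a0 k.
have: braket (f (enum_val k)) 0 = 0.
  by rewrite /braket big1 // => t _; rewrite ffunE mulr0.
rewrite -a0 (reindex _ (onW_bij _ (enum_rank_bij I))) /=.
have -> : \sum_i a (enum_rank i) *: (codom f)`_(enum_rank i)
          = \1%VF (\sum_i a (enum_rank i) *: f i).
  by rewrite id_lfunE; apply: eq_bigr => i _; rewrite nth_codom enum_rankK.
have -> : f (enum_val k) = \sum_(i : unit) 1 *: f (enum_val k).
  by rewrite (big_pred1 tt) ?scale1r // => -[].
rewrite braket_sum (big_pred1 tt) => [|[]] //.
rewrite (bigD1 (enum_val k)) //= id_lfunE orth eqxx rmorph1 mul1r mulr1.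
rewrite enum_valK big1 ?addr0 // => i /negPf ne.
by rewrite id_lfunE orth eq_sym ne mulr0.
Qed.

End HilbertSpace.

(** * Supports of operators and their matrix elements *)

Section Weight.
Variables (C : numClosedFieldType) (F : finFieldType) (N : nat).
Implicit Types (x y : 'rV[F]_N) (W : 'End(state C F N)).

Lemma word_eqE (i : 'I_N) x y :
  (x == y) = (x 0 i == y 0 i) && (col' i x == col' i y).
Proof.
apply/eqP/andP => [->|[/eqP eqi /eqP eqc]]; first by rewrite !eqxx.
apply/rowP => j; case: (unliftP i j) => [j'|] -> //.
by have /rowP/(_ j') := eqc; rewrite !mxE.
Qed.

(** By definition, [weight W] is the cardinality of this set. *)
Definition nontrivial_support W : {set 'I_N} :=
  [set i | `[< ~ acts_trivially W i >]].

Lemma notin_nontrivial_support W i :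
  i \notin nontrivial_support W -> acts_trivially W i.
Proof. by rewrite inE => /asboolP/contrapT. Qed.

(** An identity factor at [i] contributes a Kronecker delta in coordinate [i]. *)
Lemma mel_neq0_agree W x y :
  mel x W y != 0 -> {in ~: nontrivial_support W, forall i, x 0 i = y 0 i}.
Proof.
move=> nz i; rewrite inE => /notin_nontrivial_support[W' EW].
by apply/eqP; apply: contraNT nz => /negPf ne; rewrite EW ne mul0r.
Qed.

(* Changes x into y one coordinate outside the support at a time. *)
Lemma mel_diag_agree W x y :
  {in nontrivial_support W, forall i, x 0 i = y 0 i} -> mel x W x = mel y W y.
Proof.
have [d] := ubnP #|[set i | x 0 i != y 0 i]|.
elim: d => // d IHd in x *; rewrite ltnS => led agr.
have [->//|nexy] := eqVneq x y.
have [i nei] : exists i, x 0 i != y 0 i.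
  by apply/existsP; apply: contraNT nexy => /existsPn eqxy;
     apply/eqP/rowP => i; have := eqxy i; rewrite negbK => /eqP.
have Si : i \notin nontrivial_support W.
  by apply: contraNN nei => /agr ->.
pose x' : 'rV[F]_N := \row_j (if j == i then y 0 i else x 0 j).
have [W' EW] := notin_nontrivial_support Si.
have -> : mel x W x = mel x' W x'.
  rewrite !EW !eqxx; congr (_ * mel _ _ _);
    by apply/rowP => j; rewrite !mxE eq_sym (negPf (neq_lift _ _)).
apply: IHd => [|j Sj].
  apply: leq_trans led; apply: proper_card; apply/properP; split.
    apply/subsetP => j; rewrite !inE mxE.
    by case: (eqVneq j i) => [->|]; rewrite ?eqxx.
  by exists i; rewrite !inE ?mxE ?eqxx.
rewrite mxE; case: (eqVneq j i) => [eqji|_]; last exact: agr.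
by rewrite -eqji Sj in Si.
Qed.

Definition zero_projector (S : {set 'I_N}) : 'End(state C F N) :=
  op_of_mel (fun x y => ((x == y) && [forall i in S, x 0 i == 0])%:R).

(** At a position outside [S] the projector has an identity factor, and the condition on [S] carries
    over to the other factors along [lift i]. *)
Lemma weight_zero_projector S : (weight (zero_projector S) <= #|S|)%N.
Proof.
apply/subset_leq_card/subsetP => i; rewrite inE => /asboolP ntriv.
apply/contraT => Si; case: ntriv.
exists (op_of_mel (fun u v : 'rV[F]_N.-1 => ((u == v) &&
  [forall j, (lift i j \in S) ==> (u 0 j == 0)])%:R)) => x y.
rewrite !mel_op_of_mel (word_eqE i) -natrM mulnb -andbA.
congr (_ && (_ && _))%:R.
apply/forall_inP/forallP => [x0 j|x0 j Sj].
  by apply/implyP => /x0; rewrite mxE.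
have [j' eqj|eqj] := unliftP i j; last by rewrite -eqj Sj in Si.
by have := x0 j'; rewrite -eqj Sj mxE -eqj.
Qed.

End Weight.

(** * Restriction of words to a set of positions *)

Section Restriction.
Variables (F : finFieldType) (N : nat).
Implicit Types (S : {set 'I_N}) (x y : 'rV[F]_N).

Lemma restr_eqP S x y :
  reflect {in S, forall i, x 0 i = y 0 i} (restr S x == restr S y).
Proof.
apply: (iffP eqP) => [/rowP eqxy i Si|eqxy].
  by have := eqxy (enum_rank_in Si i); rewrite !mxE enum_rankK_in.
by apply/rowP => j; rewrite !mxE eqxy ?enum_valP.
Qed.

Lemma restrD S x y : restr S (x + y) = restr S x + restr S y.
Proof. by apply/rowP => j; rewrite !mxE. Qed.

Lemma restr_surj S (z : 'rV[F]_#|S|) : exists x, restr S x = z.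
Proof.
(* Extend [z] by zero outside [S]. *)
exists (\row_i (if [pick j | enum_val j == i] is Some j then z 0 j else 0)).
apply/rowP => j; rewrite !mxE; case: pickP => [j' /eqP/enum_val_inj -> //|].
by move/(_ j); rewrite eqxx.
Qed.

End Restriction.

(** * The quantum code of a punctured code, with K = k - 1 and N = n - 1 *)

Section PuncturedCode.
Variables (C : numClosedFieldType) (F : finFieldType) (K N : nat).
Variables (G : 'M[F]_(K, N)) (e : 'rV[F]_N).

Definition word (u : 'rV[F]_K) (m : F) : 'rV[F]_N := u *m G + m *: e.

(* Any K positions determine u once m is known, and any K + 1 positions
   determine both u and m. *)
Definition positions_determine_word :=
  forall (S : {set 'I_N}) u u' m m', (K + (m != m') <= #|S|)%N ->
    {in S, forall i, word u m 0 i = word u' m' 0 i} -> u = u' /\ m = m'.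

Hypotheses (determined : positions_determine_word) (ltKN : (K.*2 < N)%N).

Definition code_ket (m : F) : state C F N := \sum_u ket (word u m).

Lemma X_string_pow_code_state m :
  X_string_pow C e m (code_state C G) = code_ket m.
Proof.
rewrite /code_state linear_sum; apply: eq_bigr => u _.
exact: X_string_ket.
Qed.

Lemma word_inj u u' m m' : word u m = word u' m' -> u = u' /\ m = m'.
Proof.
move=> eqw; apply: (determined (S := setT)) => [|i _]; last by rewrite eqw.
rewrite cardsT card_ord; apply: leq_trans ltKN.
by rewrite -addnn -addn1 leq_add ?leq_b1 // leq_addr.
Qed.

(** As 2K < N, the complement of [S] still has at least K + 1 positions. *)
Lemma determined_off_support (S : {set 'I_N}) u u' m m' :
  (#|S| <= K)%N -> {in ~: S, forall i, word u m 0 i = word u' m' 0 i} ->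
  u = u' /\ m = m'.
Proof.
move=> leSK; apply: determined; rewrite cardsCs setCK card_ord.
apply: leq_trans (leq_sub2l N leSK); rewrite leq_subRL; last first.
  by rewrite (leq_trans _ (ltnW ltKN)) // -addnn leq_addr.
by rewrite addnA addnn (leq_trans _ ltKN) // -addn1 leq_add2l leq_b1.
Qed.

(** Once [S] is enlarged to exactly K positions, restriction of the words [u *m G] is an injection
    between two sets of size q^K, hence a bijection. *)
Lemma restr_code_surj (S : {set 'I_N}) (z : 'rV[F]_#|S|) :
  (#|S| <= K)%N -> exists u, restr S (u *m G) = z.
Proof.
move=> leSK; have [x <-] := restr_surj z.
have [|T sST cardT] := @exists_superset_card _ S K.
  by rewrite leSK card_ord (leq_trans _ (ltnW ltKN)) // -addnn leq_addr.
have inj : injective (fun u => restr T (u *m G)).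
  move=> u u' /eqP/restr_eqP eqT.
  have [||//] := @determined T u u' 0 0; first by rewrite eqxx addn0 cardT.
  by move=> i Ti; rewrite /word !scale0r !addr0 eqT.
have [|g _ fK] := inj_card_bij inj; first by rewrite !card_mx cardT.
exists (g (restr T x)); apply/eqP/restr_eqP => i Si.
by have /eqP/restr_eqP -> // := fK (restr T x); apply: (subsetP sST).
Qed.

Lemma sum_code_state (f : 'rV[F]_N -> C) :
  \sum_x f x * code_state C G x = \sum_u f (u *m G).
Proof.
under eq_bigr do rewrite sum_ffunE mulr_sumr.
rewrite exchange_big; apply: eq_bigr => u _ /=.
rewrite (bigD1 (u *m G)) //= ffunE eqxx mulr1 big1 ?addr0 // => x /negPf ne.
by rewrite ffunE ne mulr0.
Qed.

Lemma code_state_conj x : (code_state C G x : C)^* = code_state C G x.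
Proof.
rewrite sum_ffunE rmorph_sum; apply: eq_bigr => u _.
by rewrite ffunE /= rmorph_nat.
Qed.

(** At the zero word, [u = 0] contributes 1 to the amplitude and the other terms are nonnegative. *)
Lemma code_state_neq0 : code_state C G != 0.
Proof.
apply/eqP => /ffunP/(_ 0); rewrite sum_ffunE (bigD1 0) //= !ffunE mul0mx eqxx.
apply/eqP; rewrite gt_eqF // ltr_wpDr ?ltr01 ?sumr_ge0 // => u _.
by rewrite ffunE ler0n.
Qed.

Lemma code_state_uniform : is_uniform K (code_state C G).
Proof.
split=> [|S leSK]; first exact: code_state_neq0.
(* The constant counts the [u] whose word vanishes on [S]. *)
exists (\sum_u (restr S (u *m G) == 0)%:R) => z z'.
have -> : reduced_density (code_state C G) z z' =
    \sum_u \sum_u' ((restr S (u *m G) == z) && (restr S (u' *m G) == z')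
       && (restr (~: S) (u *m G) == restr (~: S) (u' *m G)))%:R.
  rewrite -[RHS](sum_code_state (fun x => \sum_u' ((restr S x == z)
    && (restr S (u' *m G) == z')
    && (restr (~: S) x == restr (~: S) (u' *m G)))%:R)).
  rewrite /reduced_density big_mkcond; apply: eq_bigr => x _.
  rewrite -(sum_code_state (fun y => ((restr S x == z) && (restr S y == z')
       && (restr (~: S) x == restr (~: S) y))%:R)).
  case: eqP => _; last by rewrite big1 ?mul0r // => y _; rewrite mul0r.
  rewrite big_mkcond mulr_suml; apply: eq_bigr => y _ /=.
  by case: ifP; rewrite ?mul0r // mul1r code_state_conj mulrC.
have diag u u' : (restr (~: S) (u *m G) == restr (~: S) (u' *m G)) = (u == u').
  apply/restr_eqP/eqP => [eqS|-> //].
  have [|//] := @determined_off_support S u u' 0 0 leSK.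
  by move=> i Si; rewrite /word !scale0r !addr0 eqS.
have -> : \sum_u \sum_u' ((restr S (u *m G) == z) && (restr S (u' *m G) == z')
       && (restr (~: S) (u *m G) == restr (~: S) (u' *m G)))%:R
    = \sum_u ((restr S (u *m G) == z) && (z == z'))%:R :> C.
  apply: eq_bigr => u _; rewrite (bigD1 u) //= diag eqxx andbT big1 ?addr0.
    by case: eqP => [->|].
  by move=> u' /negPf ne; rewrite diag [u == u']eq_sym ne andbF.
case: eqP => _; last by rewrite mulr0 big1 // => u _; rewrite andbF.
rewrite mulr1; have [u0 u0P] := restr_code_surj z leSK.
(* The fibre of the restriction over [z] is the fibre over 0 translated by [u0]. *)
rewrite (reindex_inj (addIr u0)); apply: eq_bigr => u _.
by rewrite andbT mulmxDl restrD u0P -subr_eq0 addrK.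
Qed.

Lemma braket_code_ket m m' (W : 'End(state C F N)) :
  braket (code_ket m) (W (code_ket m'))
  = \sum_u \sum_u' mel (word u m) W (word u' m').
Proof.
have sumE k : code_ket k = \sum_u (1 : C) *: ket (word u k).
  by apply: eq_bigr => u _; rewrite scale1r.
rewrite !sumE braket_sum; apply: eq_bigr => u _; apply: eq_bigr => u' _.
by rewrite rmorph1 !mul1r.
Qed.

(** The diagonal terms of the unnormalized matrix element of [W] at psi_0; divided by q^K, it is the
    function f of the Knill-Laflamme condition. *)
Definition KL_value (W : 'End(state C F N)) : C :=
  \sum_u mel (u *m G) W (u *m G).

(* Translating the codewords by one that agrees with m *: e on the support of
   W makes the diagonal terms independent of m. *)
Lemma code_ket_KL m m' (W : 'End(state C F N)) : (weight W <= K)%N ->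
  braket (code_ket m) (W (code_ket m')) = KL_value W * (m == m')%:R.
Proof.
move=> leWK; rewrite braket_code_ket.
have off u u' : (u, m) != (u', m') -> mel (word u m) W (word u' m') = 0.
  apply: contraNeq => /mel_neq0_agree/determined_off_support.
  by case=> // -> ->.
have [eqm|nem] := eqVneq m m'; last first.
  rewrite mulr0 big1 // => u _; rewrite big1 // => u' _; apply: off.
  by rewrite xpair_eqE (negPf nem) andbF.
have [u0 /eqP/restr_eqP u0P] :=
  restr_code_surj (restr (nontrivial_support W) (m *: e)) leWK.
rewrite mulr1 /KL_value [RHS](reindex_inj (addIr u0)); apply: eq_bigr => u _.
rewrite (bigD1 u) //= big1 => [|u' neu]; last first.
  by apply: off; rewrite xpair_eqE eq_sym (negPf neu).
rewrite addr0 -eqm; apply: mel_diag_agree => i Si.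
by rewrite mulmxDl /word [LHS]mxE [RHS]mxE u0P.
Qed.

(** By [word_inj], the kets summed in all the [code_ket m] are distinct basis vectors, q^K of them
    for each [m]. *)
Lemma braket_code_ket1 m m' :
  braket (code_ket m) (code_ket m') = (#|F| ^ K)%:R * (m == m')%:R.
Proof.
rewrite -[code_ket m']id_lfunE braket_code_ket.
under eq_bigr do under eq_bigr do rewrite /mel braket_ket id_lfunE ffunE.
have -> : (#|F| ^ K)%:R = \sum_(u : 'rV[F]_K) 1 :> C.
  by rewrite sumr_const card_mx mul1n.
rewrite mulr_suml; apply: eq_bigr => u _; rewrite mul1r.
rewrite (bigD1 u) //= big1 => [|u' /eqP neu]; last first.
  by case: eqP => // /word_inj[/esym].
by rewrite addr0; congr _%:R; congr nat_of_bool;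
   apply/eqP/eqP => [/word_inj[]|->].
Qed.

Definition unit_code_ket (m : F) : state C F N :=
  sqrtC (#|F| ^ K)%:R^-1 *: code_ket m.

Lemma sqrt_scale_neq0 : sqrtC (#|F| ^ K)%:R^-1 != 0 :> C.
Proof.
rewrite sqrtC_eq0 invr_eq0 pnatr_eq0 -lt0n expn_gt0.
by rewrite (cardD1 (0 : F)).
Qed.

Lemma sqrt_scale_conj :
  (sqrtC (#|F| ^ K)%:R^-1)^* * sqrtC (#|F| ^ K)%:R^-1 = (#|F| ^ K)%:R^-1 :> C.
Proof.
have ge0 : 0 <= (#|F| ^ K)%:R^-1 :> C by rewrite invr_ge0 ler0n.
by rewrite conj_Creal ?ger0_real ?sqrtC_ge0 // -expr2 sqrtCK.
Qed.

Lemma unit_code_ket_orthonormal m m' :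
  braket (unit_code_ket m) (unit_code_ket m') = (m == m')%:R.
Proof.
rewrite -[X in braket _ X]id_lfunE braketZ id_lfunE braket_code_ket1.
rewrite mulrA sqrt_scale_conj mulVf ?mul1r //.
by have := sqrt_scale_neq0; rewrite sqrtC_eq0 invr_eq0.
Qed.

Definition code_space : {vspace state C F N} := <<codom code_ket>>%VS.

(** The reindexing [h] is there because [is_QECC] numbers its basis by an ordinal type instead of
    [F]. *)
Lemma unit_code_ket_basis (I : finType) (h : I -> F) : bijective h ->
  basis_of code_space (codom (unit_code_ket \o h)).
Proof.
case=> g hK gK; rewrite /basis_of; apply/andP; split; last first.
  apply: orthonormal_free => i j.
  by rewrite unit_code_ket_orthonormal (can_eq hK).
rewrite eqEsubv; apply/andP; split; apply/span_subvP => _ /codomP [x ->].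
  by rewrite memvZ // memv_span // codom_f.
have -> : code_ket x =
    (sqrtC (#|F| ^ K)%:R^-1)^-1 *: (unit_code_ket \o h) (g x).
  by rewrite /= gK /unit_code_ket scalerA mulVf ?scale1r ?sqrt_scale_neq0.
by rewrite memvZ // memv_span // codom_f.
Qed.

(** If the weight is at most K, then on the code space both the form of [W] and the inner product
    are multiples of the sum of [(a i)^* * b i]. The second multiple, q^K, is nonzero, so
    orthogonality annihilates the first form too. *)
Lemma code_ket_not_confused (W : 'End(state C F N)) :
  confuses code_space W -> (K < weight W)%N.
Proof.
case=> phi [psi [/mem_span_codom[a ->] /mem_span_codom[b ->] orth]].
rewrite ltnNge; apply: contraNN => leWK; apply/eqP.
have sumE (V : 'End(state C F N)) c :
    (forall m m', braket (code_ket m) (V (code_ket m')) = c * (m == m')%:R) ->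
    braket (\sum_i a i *: code_ket i) (V (\sum_i b i *: code_ket i))
      = c * \sum_i (a i)^* * b i.
  move=> VP; rewrite braket_sum mulr_sumr; apply: eq_bigr => i _.
  rewrite (bigD1 i) //= VP eqxx mulr1 mulrC big1 ?addr0 // => j /negPf ne.
  by rewrite VP eq_sym ne !mulr0.
rewrite (sumE W (KL_value W)) => [|m m']; last exact: code_ket_KL.
have := sumE \1%VF (#|F| ^ K)%:R; rewrite id_lfunE orth => /(_ _)/esym/eqP.
rewrite mulf_eq0 => /(_ _)/orP -[m m'||/eqP ->]; rewrite ?mulr0 //.
  by rewrite id_lfunE braket_code_ket1.
by have := sqrt_scale_neq0; rewrite sqrtC_eq0 invr_eq0 => /negPf ->.
Qed.

Lemma code_space_confused :
  exists2 W, confuses code_space W & weight W = K.+1.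
Proof.
have [|S _ cardS] := @exists_superset_card _ (set0 : {set 'I_N}) K.+1.
  rewrite cards0 card_ord /= (leq_trans _ ltKN) // ltnS -addnn leq_addr //.
have memC m : code_ket m \in code_space by rewrite memv_span ?codom_f.
pose W : 'End(state C F N) := zero_projector C F S.
have WE m m' : braket (code_ket m) (W (code_ket m'))
    = ((m == 0) && (m' == 0))%:R.
  have W0 u u' : mel (word u m) W (word u' m')
      = [&& u == 0, m == 0, u' == 0 & m' == 0]%:R.
    rewrite mel_op_of_mel; congr _%:R; congr nat_of_bool.
    (* A word vanishing on the K + 1 positions of [S] agrees there with [word 0 0], so it is that
       word. *)
    apply/andP/and4P => [[/eqP/word_inj[-> ->] /forall_inP w0]|].
      have [||-> ->] := @determined S u' 0 m' 0; rewrite ?eqxx //.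
        by rewrite cardS -addn1 leq_add2l leq_b1.
      by move=> i /w0/eqP ->; rewrite /word mul0mx scale0r addr0 mxE.
    move=> [/eqP -> /eqP -> /eqP -> /eqP ->]; rewrite eqxx; split=> //.
    by apply/forall_inP => i _; rewrite /word mul0mx scale0r addr0 mxE.
  rewrite braket_code_ket (bigD1 0) //= (bigD1 0) //= W0 !eqxx /=.
  rewrite big1 => [|u /negPf ne]; last by rewrite W0 ne !andbF.
  rewrite big1 => [|u /negPf ne]; first by rewrite !addr0.
  by rewrite big1 // => u' _; rewrite W0 ne.
have confW : confuses code_space W.
  (* [phi c] is psi_0 + c psi_1: for c = 1 and c = -1 these are orthogonal because psi_0 and psi_1
     are orthogonal of equal norm, while [W] keeps only the psi_0 term. *)
  pose s (c : C) (i : bool) : C := if i then c else 1.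
  pose f (i : bool) := code_ket (i : nat)%:R.
  pose phi c : state C F N := \sum_(i : bool) s c i *: f i.
  have memf c : phi c \in code_space.
    by apply: memv_suml => i _; apply: memvZ; apply: memC.
  exists (phi 1), (phi (-1)).
  split=> //.
    rewrite -[X in braket _ X]id_lfunE braket_sum !big_bool /s /f /=.
    rewrite !id_lfunE !braket_code_ket1 !eqxx oner_eq0 eq_sym oner_eq0.
    by rewrite rmorph1 !mul1r !mulr0 mulr1 addr0 add0r mulN1r addNr.
  rewrite braket_sum !big_bool /s /f /= !WE eqxx oner_eq0.
  by rewrite rmorph1 !mul1r !mulr0 !add0r oner_neq0.
(* Since [W] confuses the code, its weight exceeds K; the size of [S] gives the upper bound. *)
exists W => //; apply/eqP; rewrite eqn_leq code_ket_not_confused // andbT.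
by rewrite -cardS weight_zero_projector.
Qed.

Lemma code_space_QECC : is_QECC code_space N 1 K.+1.
Proof.
have bij_h : bijective (fun m : 'I_(#|F| ^ 1) =>
    enum_val (cast_ord (expn1 _) m) : F).
  exists (fun x => cast_ord (esym (expn1 _)) (enum_rank x)) => m.
    by rewrite enum_valK cast_ordK.
  by rewrite cast_ordKV enum_rankK.
set h := (X in bijective X) in bij_h.
have basis := unit_code_ket_basis bij_h.
split=> //.
- by rewrite (size_basis (X := codom_tuple _) basis) card_ord.
- exists (unit_code_ket \o h); split=> // [m m'|].
    by rewrite unit_code_ket_orthonormal (bij_eq bij_h).
  exists (fun W => (#|F| ^ K)%:R^-1 * KL_value W) => m m' E1 E2 W ltW.
  rewrite braketZ code_ket_KL // sqrt_scale_conj mulrA.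
  by rewrite (bij_eq bij_h).
split; first exact: code_space_confused.
exact: code_ket_not_confused.
Qed.

End PuncturedCode.

(** * Puncturing an MDS code in one systematic coordinate *)

Section Puncturing.
Variable F : finFieldType.

Lemma hamming_distE l (x y : 'rV[F]_l) :
  hamming_dist x y = (\sum_i (x 0%R i != y 0%R i))%N.
Proof. by rewrite /hamming_dist -sum1dep_card big_mkcond. Qed.

Lemma hamming_dist_agree l (x y : 'rV[F]_l) (S : {set 'I_l}) :
  {in S, forall i, x 0 i = y 0 i} -> (hamming_dist x y + #|S| <= l)%N.
Proof.
move=> eqxy; rewrite -[leqRHS]card_ord -[leqRHS](cardC S) addnC leq_add2l.
apply/subset_leq_card/subsetP => i; rewrite !inE.
by apply: contraNN => /eqxy ->.
Qed.

Lemma hamming_dist_row_mx l1 l2 (x1 y1 : 'rV[F]_l1) (x2 y2 : 'rV[F]_l2) :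
  hamming_dist (row_mx x1 x2) (row_mx y1 y2)
  = (hamming_dist x1 y1 + hamming_dist x2 y2)%N.
Proof.
rewrite !hamming_distE big_split_ord /=.
by congr (_ + _)%N; apply: eq_bigr => i _; rewrite ?row_mxEl ?row_mxEr.
Qed.

(** Rebuilds the message of the original code from the punctured message [u] and the deleted letter
    [m]. *)
Definition insert_coord k (i : 'I_k) (u : 'rV[F]_k.-1) (m : F) : 'rV[F]_k :=
  \row_j (if unlift i j is Some j' then u 0 j' else m).

Lemma insert_coord_inj k (i : 'I_k) u u' m m' :
  insert_coord i u m = insert_coord i u' m' -> u = u' /\ m = m'.
Proof.
move=> /rowP eqv; split; last by have := eqv i; rewrite !mxE unlift_none.
by apply/rowP => j; have := eqv (lift i j); rewrite !mxE liftK.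
Qed.

Lemma hamming_dist_insert k (i : 'I_k) u u' m m' :
  hamming_dist (insert_coord i u m) (insert_coord i u' m')
  = (hamming_dist u u' + (m != m'))%N.
Proof.
rewrite !hamming_distE (bigD1_ord i) //= addnC !mxE unlift_none.
by congr (_ + _)%N; apply: eq_bigr => j _; rewrite !mxE liftK.
Qed.

(** Identifies the last block of [word u m] with the check part of a codeword of the original
    code. *)
Lemma insert_coord_mulmx k l (i : 'I_k) u m (A : 'M[F]_(k, l)) :
  insert_coord i u m *m A = u *m row' i A + m *: row i A.
Proof.
apply/rowP => j; rewrite !mxE (bigD1_ord i) //= addrC mxE unlift_none.
by congr (_ + _); apply: eq_bigr => j' _; rewrite !mxE liftK.
Qed.

Lemma mulmx_generator_in k l (G : 'M[F]_(k, l)) D (v : 'rV[F]_k) :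
  is_generator_matrix G D -> v *m G \in D.
Proof.
move=> /andP[/eqP <- _]; rewrite mulmx_sum_row memv_suml // => i _.
by rewrite memvZ // memv_span //; apply/mapP; exists i; rewrite ?mem_enum.
Qed.

(* Deleting coordinate i of D leaves the words below, at distances that drop
   by one exactly when the deleted coordinates m and m' differ. *)
Lemma MDS_positions_determine_word n k (i : 'I_k) (A : 'M[F]_(k, n - k)) D :
  (k <= n)%N -> is_MDS D n k -> is_generator_matrix (row_mx 1%:M A) D ->
  positions_determine_word (row_mx 1%:M (row' i A)) (row_mx 0 (row i A)).
Proof.
move=> lekn [_ _ [_ min_dist]] genD S u u' m m' leS agr.
have codeE v : v *m row_mx 1%:M A = row_mx v (v *m A).
  by rewrite mul_mx_row mulmx1.
have wordE w c : word (row_mx 1%:M (row' i A)) (row_mx 0 (row i A)) w c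
    = row_mx w (insert_coord i w c *m A).
  rewrite /word mul_mx_row mulmx1 scale_row_mx add_row_mx scaler0 addr0.
  by rewrite insert_coord_mulmx.
set v := insert_coord i u m; set v' := insert_coord i u' m'.
have [/insert_coord_inj //|nev] := eqVneq v v'.
have := min_dist _ _ (mulmx_generator_in v genD) (mulmx_generator_in v' genD).
rewrite !codeE hamming_dist_row_mx hamming_dist_insert.
have -> : row_mx v (v *m A) != row_mx v' (v' *m A).
  by apply: contraNneq nev => /eq_row_mx[->].
move=> /(_ isT); have := hamming_dist_agree agr.
rewrite !wordE -/v -/v' hamming_dist_row_mx.
have lek : (0 < k)%N := leq_ltn_trans (leq0n i) (ltn_ord i).
(* With b = 1 if [m != m'] and b = 0 otherwise, the punctured words are at distance at least n - k +
   1 - b, yet agree on k - 1 + b positions: n in total, against length n - 1. *)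
move: leS lekn lek; case: (m != m') => /=; lia.
Qed.

End Puncturing.

Theorem lemma1 (R : realType) (F : finFieldType) (n k : nat)
    (hk : (1 <= k)%N) (hkn : (k <= n./2)%N)
    (A : 'M[F]_(k, n - k)) (D : {vspace 'rV[F]_(k + (n - k))})
    (hD : is_MDS D n k)
    (hG : is_generator_matrix (row_mx 1%:M A) D) :
  let last := last_ord hk in
  let Ghat : 'M[F]_(k.-1, k.-1 + (n - k)) := row_mx 1%:M (row' last A) in
  let psi0 : state R[i] F (k.-1 + (n - k)) := code_state R[i] Ghat in
  let e : 'rV[F]_(k.-1 + (n - k)) := row_mx 0 (row last A) in
  let psi := fun m : F => X_string_pow R[i] e m psi0 in
  let Q : {vspace state R[i] F (k.-1 + (n - k))} := <<codom psi>>%VS in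
  is_uniform k.-1 psi0 /\ is_QECC Q n.-1 1 k.
Proof.
move=> last Ghat psi0 e psi Q.
have lekn : (k <= n)%N by lia.
(* This is 2(k - 1) < n - 1, which follows from 2k <= n. *)
have ltKN : (k.-1.*2 < k.-1 + (n - k))%N by lia.
have determined := MDS_positions_determine_word (i := last) lekn hD hG.
split; first exact: code_state_uniform determined ltKN.
have -> : Q = code_space R[i] Ghat e.
  by rewrite /Q (eq_codom (X_string_pow_code_state R[i] Ghat e)).
have := code_space_QECC R[i] determined ltKN.
by rewrite prednK // => -[_ dimQ basisQ distQ]; split=> //; lia.
Qed.
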